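(* Fix $\theta\in[-1,1]$ and $\mu\in\mathcal{C}_{1,\theta}$. Then $$G_\mu(iy)-\frac{1}{iy}=-\frac{1}{y^2}\int_{-y}^{y}t\,d\mu(t)+if(y)+o(1)g(y)\quad\text{as }y\to\infty,$$ where $f,g\in\mathcal{R}_{-2}$ satisfy $$g(y)\sim\frac{1}{y^2}\int_{-y}^{y}|t|\,d\mu(t)\quad\text{as }y\to\infty$$ and $$f(y)\sim\frac{\pi}{2}\,\frac1y\,\mu(\{t:|t|>y\})=o(g(y))\quad\text{as }y\to\infty.$$
   Context: For a Borel probability measure $\mu$ on $\mathbf{R}$, $G_\mu(z)=\int_{-\infty}^\infty\frac{1}{z-t}\,d\mu(t)$ for $\Im z>0$. $\mathcal{R}_\rho$ is the class of regularly varying functions of index $\rho$: positive Borel functions $r$ defined in a neighborhood of $+\infty$ of the form $r(y)=y^\rho\ell(y)$ with $\ell$ slowly varying, i.e. $\lim_{x\to\infty}\ell(tx)/\ell(x)=1$ for all $t>0$. The notation $f\sim g$ as $y\to\infty$ means $f(y)/g(y)\to1$. $\mathcal{C}_{1,\theta}$ is the set of Borel probability measures $\mu$ on $\mathbf{R}$ such that (a) $y\mapsto\int_{-y}^{y}t^2\,d\mu(t)$ varies regularly with index $1$, and (b) $\lim_{t\to\infty}\frac{\mu((t,\infty))-\mu((-\infty,-t))}{\mu((t,\infty))+\mu((-\infty,-t))}=\theta$. *)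

(* Defs.v *)
From HB Require Import structures.
From mathcomp Require Import all_boot all_order all_algebra.
From mathcomp Require Import complex.
From mathcomp Require Import all_classical all_reals all_analysis.

Set Implicit Arguments.
Unset Strict Implicit.
Unset Printing Implicit Defensive.

Import Order.TTheory GRing.Theory Num.Theory.
Import numFieldNormedType.Exports.

Local Open Scope classical_set_scope.
Local Open Scope complex_scope.
Local Open Scope ring_scope.

(* Makes Landau notations at +oo available. *)
Canonical pinfty_filter_on (R : realType) : filter_on R :=
  FilterType (pinfty_nbhs R) (@proper_pinfty_nbhs R).

Definition asymp_equiv (R : realType) (f g : R -> R) : Prop :=
  f y / g y @[y --> +oo] --> (1 : R).

Definition slowly_varying (R : realType) (l : R -> R) : Prop :=
  forall t : R, 0 < t -> l (t * x) / l x @[x --> +oo] --> (1 : R).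

(* A function "defined in a neighborhood of +oo" is a total function of which
   only the values on some ]a, +oo[ matter. Since the neighborhood may be
   shrunk, a >= 0 loses no generality; it keeps y `^ rho away from y <= 0. *)
Definition regularly_varying (R : realType) (rho : R) (r : R -> R) : Prop :=
  exists a : R, [/\ 0 <= a,
    measurable_fun `]a, +oo[ r,
    forall y, a < y -> 0 < r y &
    exists l : R -> R,
      slowly_varying l /\ forall y, a < y -> r y = y `^ rho * l y].

(* The Lebesgue integral of a complex-valued function, by real and imaginary
   parts. *)
Definition complex_integral (R : realType)
    (mu : probability (measurableTypeR R) R) (F : R -> R[i]) : R[i] :=
  (\int[mu]_t complex.Re (F t)) +i* (\int[mu]_t complex.Im (F t)).

Definition cauchy_transform (R : realType)
    (mu : probability (measurableTypeR R) R) (z : R[i]) : R[i] :=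
  complex_integral mu (fun t => (z - t%:C)^-1).

(* C_{1,theta}: the laws of stable index 1 and asymmetry theta, i.e. truncated
   second moment of index 2 - 1 = 1 and tail balance theta. *)
Definition stable_class1 (R : realType) (theta : R)
    (mu : probability (measurableTypeR R) R) : Prop :=
  regularly_varying 1 (fun y => \int[mu]_(t in `[- y, y]) (t ^+ 2)) /\
  (fine (mu `]t, +oo[%classic) - fine (mu `]-oo, (- t)[%classic)) /
    (fine (mu `]t, +oo[%classic) + fine (mu `]-oo, (- t)[%classic)) @[t --> +oo] --> theta.

(* Main.v *)
Require Import Defs.
From HB Require Import structures.
From mathcomp Require Import all_boot all_order all_algebra.
From mathcomp Require Import complex ring lra.
From mathcomp Require Import all_classical all_reals all_analysis.
From mathcomp Require Import measurable_realfun.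

Set Implicit Arguments.
Unset Strict Implicit.
Unset Printing Implicit Defensive.

Import Order.TTheory GRing.Theory Num.Theory.
Import numFieldNormedType.Exports.

Local Open Scope classical_set_scope.
Local Open Scope complex_scope.
Local Open Scope ring_scope.

(** Write [U y] for the integral of [t ^+ 2] over [-y, y], [V y] for that of
    [|t|], and [T y] for the mass of [|t| > y].

    The kernel [1 / (i y - t)] has real part [- t / (t ^+ 2 + y ^+ 2)] and
    imaginary part [- y / (t ^+ 2 + y ^+ 2)]. Subtracting [1 / (i y) = - i / y]
    turns the imaginary part of the transform into
    [f y = y^-1 * J y], with [J y] the integral of [t ^+ 2 / (t ^+ 2 + y ^+ 2)];
    this is the [f] of the statement, and [g y = y ^- 2 * V y].

    The hypothesis says that [U (t y) / U y] tends to [t]: the measure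
    [t ^+ 2 dmu], seen at scale [y] and divided by [U y], converges to Lebesgue
    measure on the half-line. Hence, for a decreasing [h] with [h s <= s ^- 2],
    the integral of [h (|t| / y) t ^+ 2] over [|t| > a y], divided by [U y],
    tends to the integral of [h] over [s > a] ([weighted_outside_cvg]). On
    bounded ranges this is a Riemann sum argument ([weighted_shell_cvg]), and the
    remaining part is controlled by [T x <= 8 U x / x ^+ 2] ([tail_bound]). With
    [h s = s ^- 2] on [s > 1] one gets [T y ~ U y / y ^+ 2]; with
    [h s = 1 / (1 + s ^+ 2)] one gets [J y ~ (pi / 2) U y / y ^+ 2], the constant
    being the limit of [atan]. So [f y ~ (pi / 2) T y / y], and [f] inherits its
    index from [U].

    Each dyadic shell below [y] contributes about [U y / (2 y)] to [V y], and
    arbitrarily many of them fit, so [U y / y = o(V y)] ([moment1_dominates]).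
    As [V (t y) - V y] is at most [(U (t y) - U y) / y] for [t > 1], [V] is slowly
    varying and [g] has index [-2]. Finally the real part differs from
    [- y ^- 2] times the truncated mean by at most [U y / y ^+ 3 + T y / y]
    ([cauchy_re_bound]), which is [o(g y)]. *)

(** * Integrals over shells *)

Definition shell (R : realType) (a b : R) : set R := [set t | a < `|t| <= b].

Definition outside (R : realType) (a : R) : set R := [set t | a < `|t|].

Section Truncations.
Context {R : realType} (mu : probability (measurableTypeR R) R).
Implicit Types (a b x y t : R) (D : set R) (f h : R -> R).

Definition moment1 y := \int[mu]_(t in `[- y, y]) `|t|.
Definition moment2 y := \int[mu]_(t in `[- y, y]) (t ^+ 2).
Definition tail y := fine (mu (outside y)).

Lemma measurable_shell a b : measurable (shell a b).
Proof.
have -> : shell a b = (@Num.norm R R) @^-1` `]a, b].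
  by apply/seteqP; split => t; rewrite /shell /= in_itv.
by rewrite -[X in measurable X]setTI; exact: normr_measurable.
Qed.

Lemma measurable_outside a : measurable (outside a).
Proof.
have -> : outside a = (@Num.norm R R) @^-1` `]a, +oo[.
  by apply/seteqP; split => t; rewrite /outside /= in_itv/= andbT.
by rewrite -[X in measurable X]setTI; exact: normr_measurable.
Qed.

(** On nonnegative reals, [0] included, the reciprocal is the power of exponent
    [-1], and real powers are measurable. *)
Lemma measurable_funV_ge0 f : (forall t, 0 <= f t) ->
  measurable_fun setT f -> measurable_fun setT (fun t => (f t)^-1).
Proof.
move=> f0 mf; rewrite (_ : (fun t => _) = (@powR R)^~ (-1) \o f).
  by apply: measurableT_comp mf; exact: measurable_powR.
by apply/funext => t /=; rewrite powR_inv1.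
Qed.

Lemma integrable_bounded D f M : measurable D -> measurable_fun setT f ->
  (forall t, D t -> `|f t| <= M) -> mu.-integrable D (EFin \o f).
Proof.
move=> mD mf fM; apply: measurable_bounded_integrable => //.
- exact: le_lt_trans (probability_le1 mu mD) (ltry _).
- exact: measurable_funS mf.
- by exists M; split; [exact: num_real|move=> N MN t /fM/le_trans; apply; exact: ltW].
Qed.

Lemma itv_shell a b : 0 <= a <= b -> `[- b, b]%classic = `[- a, a] `|` shell a b.
Proof.
move=> /andP[a0 ab]; apply/seteqP; split => t; rewrite /shell /= !in_itv /= -!ler_norml.
  by move=> ->; rewrite andbT; apply/orP; rewrite leNgt orNb.
by case=> [/le_trans|/andP[]]//; apply.
Qed.

Lemma outside_shell a b : a <= b -> outside a = shell a b `|` outside b.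
Proof.
move=> ab; apply/seteqP; split => t; rewrite /shell /outside /=.
  by move=> ->/=; apply/orP; rewrite leNgt orNb.
by case=> [/andP[]//|]; exact: le_lt_trans.
Qed.

Lemma shell_cat a b c : a <= b <= c -> shell a c = shell a b `|` shell b c.
Proof.
move=> /andP[ab bc]; apply/seteqP; split => t; rewrite /shell /=.
  by move=> /andP[-> ->]/=; rewrite andbT; apply/orP; rewrite leNgt orNb.
by case=> /andP[h1 h2]; [rewrite h1 (le_trans h2)|rewrite h2 (le_lt_trans ab)].
Qed.

Lemma Rintegral_itv_shell f a b M : 0 <= a <= b -> measurable_fun setT f ->
  (forall t, `|t| <= b -> `|f t| <= M) ->
  \int[mu]_(t in `[- b, b]) f t =
  \int[mu]_(t in `[- a, a]) f t + \int[mu]_(t in shell a b) f t.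
Proof.
move=> ab mf fM; rewrite (itv_shell ab); apply: Rintegral_setU.
- exact: measurable_itv.
- exact: measurable_shell.
- rewrite -itv_shell//; apply: (integrable_bounded (M := M)) => // t.
  by rewrite /= in_itv /= -ler_norml; exact: fM.
- apply/disj_setPS => t []; rewrite /shell /= in_itv /= -ler_norml.
  by move=> ta /andP[]; rewrite ltNge ta.
Qed.

Lemma Rintegral_outside_shell f a b M : a <= b -> measurable_fun setT f ->
  (forall t, a < `|t| -> `|f t| <= M) ->
  \int[mu]_(t in outside a) f t =
  \int[mu]_(t in shell a b) f t + \int[mu]_(t in outside b) f t.
Proof.
move=> ab mf fM; rewrite (outside_shell ab); apply: Rintegral_setU.
- exact: measurable_shell.
- exact: measurable_outside.
- rewrite -outside_shell//; apply: (integrable_bounded (M := M)) => //.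
  exact: measurable_outside.
- apply/disj_setPS => t []; rewrite /shell /outside /= => /andP[_].
  by rewrite leNgt => /negP.
Qed.

Lemma Rintegral_shell_cat f a b c M : a <= b <= c -> measurable_fun setT f ->
  (forall t, a < `|t| <= c -> `|f t| <= M) ->
  \int[mu]_(t in shell a c) f t =
  \int[mu]_(t in shell a b) f t + \int[mu]_(t in shell b c) f t.
Proof.
move=> ab mf fM; rewrite (shell_cat ab); apply: Rintegral_setU.
- exact: measurable_shell.
- exact: measurable_shell.
- rewrite -shell_cat//; apply: (integrable_bounded (M := M)) => //.
  exact: measurable_shell.
- apply/disj_setPS => t []; rewrite /shell /= => /andP[_ tb] /andP[].
  by rewrite ltNge tb.
Qed.

Lemma sqr_le_norm t b : `|t| <= b -> `|t ^+ 2| <= b ^+ 2.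
Proof. by move=> tb; rewrite normrX lerXn2r// ?nnegrE// (le_trans _ tb). Qed.

Lemma moment2_shell a b : 0 <= a <= b ->
  \int[mu]_(t in shell a b) (t ^+ 2) = moment2 b - moment2 a.
Proof.
move=> ab; rewrite /moment2 (@Rintegral_itv_shell _ a b (b ^+ 2))//.
- by rewrite [RHS]addrC addKr.
- by move=> t; exact: sqr_le_norm.
Qed.

Lemma moment1_shell a b : 0 <= a <= b ->
  \int[mu]_(t in shell a b) `|t| = moment1 b - moment1 a.
Proof.
move=> ab; rewrite /moment1 (@Rintegral_itv_shell _ a b b)//.
- by rewrite [RHS]addrC addKr.
- by move=> t; rewrite normr_id.
Qed.

Lemma tailE a : \int[mu]_(t in outside a) 1 = tail a.
Proof. by rewrite Rintegral_cst ?mul1r//; exact: measurable_outside. Qed.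

Lemma tail_shell a b : a <= b ->
  \int[mu]_(t in shell a b) 1 = tail a - tail b.
Proof.
move=> ab; rewrite -!tailE (@Rintegral_outside_shell _ a b 1)// ?addrK//.
by move=> t _; rewrite normr1.
Qed.

Lemma tail_ge0 a : 0 <= tail a.
Proof. exact: fine_ge0. Qed.

Lemma moment2_ge0 a : 0 <= moment2 a.
Proof. by apply: Rintegral_ge0 => t _; exact: sqr_ge0. Qed.

Lemma moment1_ge0 a : 0 <= moment1 a.
Proof. exact: Rintegral_ge0. Qed.

Lemma moment2_0 : moment2 0 = 0.
Proof.
rewrite /moment2 (@eq_Rintegral _ _ _ mu _ (cst 0)) ?Rintegral_cst ?mul0r//.
move=> t; rewrite inE /= in_itv /= -ler_norml normr_le0 => /eqP ->.
by rewrite expr0n.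
Qed.

(** The integral of [h] over the interval from [a] to [b] against the measure
    [t ^+ 2 dmu] seen at scale [y]. *)
Definition weighted_shell h a b y :=
  \int[mu]_(t in shell (a * y) (b * y)) (h (`|t| / y) * t ^+ 2).

Lemma measurable_weight h y : measurable_fun setT h ->
  measurable_fun setT (fun t => h (`|t| / y) * t ^+ 2).
Proof.
move=> mh; apply: measurable_funM; last exact: exprn_measurable.
by apply: measurableT_comp => //; apply: measurable_funM.
Qed.

Lemma shell_scale a b y t : 0 < y ->
  (a * y < `|t| <= b * y) = (a < `|t| / y <= b).
Proof. by move=> y0; rewrite ltr_pdivlMr// ler_pdivrMr. Qed.

Lemma weight_bounded h a b y t : 0 < y ->
  (forall s, a <= s <= b -> h b <= h s <= h a) ->
  a * y < `|t| <= b * y ->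
  `|h (`|t| / y) * t ^+ 2| <= (`|h a| + `|h b|) * (b * y) ^+ 2.
Proof.
move=> y0 hab tab; rewrite normrM ler_pM//; last first.
  by apply: sqr_le_norm; case/andP: tab.
move: tab; rewrite shell_scale// => /andP[/ltW at_ tb].
have := hab (`|t| / y); rewrite at_ tb => /(_ isT)/andP[h1 h2].
rewrite ler_norml; apply/andP; split.
  by have := ler_norm (- h b); have := normr_ge0 (h a); rewrite normrN; lra.
by have := ler_norm (h a); have := normr_ge0 (h b); lra.
Qed.

(** A decreasing weight lies between its endpoint values on a shell, whose mass
    for [t ^+ 2 dmu] is an increment of [moment2]: one cell of a Riemann sum. *)
Lemma weighted_shell_bounds h a b y : 0 <= a <= b -> 0 < y ->
  measurable_fun setT h -> (forall s, a <= s <= b -> h b <= h s <= h a) ->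
  h b * (moment2 (b * y) - moment2 (a * y)) <= weighted_shell h a b y
    <= h a * (moment2 (b * y) - moment2 (a * y)).
Proof.
move=> /andP[a0 ab] y0 mh hab.
have aby : 0 <= a * y <= b * y by rewrite mulr_ge0 ?ler_wpM2r ?(ltW y0).
have isq : mu.-integrable (shell (a * y) (b * y)) (EFin \o (fun t : R => t ^+ 2)).
  apply: (integrable_bounded (M := (b * y) ^+ 2)).
  - exact: measurable_shell.
  - exact: exprn_measurable.
  - by move=> t /andP[_]; exact: sqr_le_norm.
have iw : mu.-integrable (shell (a * y) (b * y))
    (EFin \o (fun t : R => h (`|t| / y) * t ^+ 2)).
  apply: (integrable_bounded (M := (`|h a| + `|h b|) * (b * y) ^+ 2)).
  - exact: measurable_shell.
  - exact: measurable_weight.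
  - by move=> t; exact: weight_bounded.
have icst c : mu.-integrable (shell (a * y) (b * y))
    (EFin \o (fun t : R => c * t ^+ 2)).
  apply: (integrable_bounded (M := `|c| * (b * y) ^+ 2)).
  - exact: measurable_shell.
  - by apply: measurable_funM => //; exact: exprn_measurable.
  - by move=> t /andP[_ tb]; rewrite normrM ler_wpM2l//; exact: sqr_le_norm.
rewrite -moment2_shell// -!RintegralZl//; [|exact: measurable_shell..].
apply/andP; split; apply: le_Rintegral => //; try exact: measurable_shell.
  move=> t; rewrite /shell /= shell_scale// => /andP[/ltW at_ tb].
  apply: ler_wpM2r; rewrite ?sqr_ge0//.
  by have := hab (`|t| / y); rewrite at_ tb => /(_ isT)/andP[].
move=> t; rewrite /shell /= shell_scale// => /andP[/ltW at_ tb].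
apply: ler_wpM2r; rewrite ?sqr_ge0//.
  by have := hab (`|t| / y); rewrite at_ tb => /(_ isT)/andP[].
Qed.

Lemma weighted_shell_cat h a b c y : a <= b <= c -> 0 < y ->
  measurable_fun setT h -> (forall s, a <= s <= c -> h c <= h s <= h a) ->
  weighted_shell h a c y = weighted_shell h a b y + weighted_shell h b c y.
Proof.
move=> /andP[ab bc] y0 mh hac.
apply: (@Rintegral_shell_cat _ _ _ _ ((`|h a| + `|h c|) * (c * y) ^+ 2)).
- by rewrite !ler_wpM2r ?(ltW y0).
- exact: measurable_weight.
- by move=> t; exact: weight_bounded.
Qed.

(** Chebyshev on a shell: [1 <= t ^+ 2 / x ^+ 2] there. *)
Lemma tail_shell_le x y : 0 < x <= y ->
  tail x - tail y <= (moment2 y - moment2 x) / x ^+ 2.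
Proof.
move=> /andP[x0 xy]; rewrite ler_pdivlMr ?exprn_gt0// -tail_shell//.
rewrite -moment2_shell ?(ltW x0)// -RintegralZr.
- apply: le_Rintegral.
  + exact: measurable_shell.
  + apply: (integrable_bounded (M := x ^+ 2)) => //; first exact: measurable_shell.
    by move=> t _; rewrite mul1r ger0_norm ?sqr_ge0.
  + apply: (integrable_bounded (M := y ^+ 2)).
    * exact: measurable_shell.
    * exact: exprn_measurable.
    * by move=> t /andP[_]; exact: sqr_le_norm.
  + move=> t /andP[/ltW xt _]; rewrite mul1r -[leRHS]real_normK ?num_real//.
    by rewrite lerXn2r// nnegrE ltW.
- exact: measurable_shell.
- apply: (integrable_bounded (M := 1)) => //; first exact: measurable_shell.
  by move=> t _; rewrite normr1.
Qed.

(** On the shell, [t ^+ 2 / y <= |t| <= t ^+ 2 / x]. *)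
Lemma moment1_shell_bounds x y : 0 < x <= y ->
  (moment2 y - moment2 x) / y <= moment1 y - moment1 x
    <= (moment2 y - moment2 x) / x.
Proof.
move=> /andP[x0 xy]; have y0 := lt_le_trans x0 xy.
rewrite ler_pdivrMr// ler_pdivlMr//.
have i1 z : mu.-integrable (shell x y) (EFin \o (fun t : R => `|t| * z)).
  apply: (integrable_bounded (M := y * `|z|)).
  - exact: measurable_shell.
  - by apply: measurable_funM => //; exact: normr_measurable.
  - by move=> t /andP[_ ty]; rewrite normrM normr_id ler_wpM2r.
have i2 : mu.-integrable (shell x y) (EFin \o (fun t : R => t ^+ 2)).
  apply: (integrable_bounded (M := y ^+ 2)).
  - exact: measurable_shell.
  - exact: exprn_measurable.
  - by move=> t /andP[_]; exact: sqr_le_norm.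
have i3 : mu.-integrable (shell x y) (EFin \o (fun t : R => `|t|)).
  apply: (integrable_bounded (M := y)).
  - exact: measurable_shell.
  - exact: normr_measurable.
  - by move=> t /andP[_ ty]; rewrite normr_id.
rewrite -moment1_shell ?(ltW x0)// -moment2_shell ?(ltW x0)//.
rewrite -!RintegralZr//; [|exact: measurable_shell..].
apply/andP; split; apply: le_Rintegral => //; try exact: measurable_shell.
  move=> t /andP[xt ty]; rewrite -[leLHS]real_normK ?num_real//.
  by rewrite expr2 ler_wpM2l.
move=> t /andP[xt ty]; rewrite -[leRHS]real_normK ?num_real//.
by rewrite expr2 ler_wpM2l// ltW.
Qed.

Lemma moment2_le_moment1 y : 0 <= y -> moment2 y <= moment1 y * y.
Proof.
move=> y0; have mI := measurable_itv `[- y, y].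
have i3 : mu.-integrable `[- y, y] (EFin \o (fun t : R => `|t|)).
  apply: (integrable_bounded (M := y)) => //.
  by move=> t; rewrite /= in_itv /= -ler_norml normr_id.
rewrite /moment1 -RintegralZr//.
apply: le_Rintegral => //.
- apply: (integrable_bounded (M := y ^+ 2)) => //.
  by move=> t; rewrite /= in_itv /= -ler_norml; exact: sqr_le_norm.
- apply: (integrable_bounded (M := y * y)) => //.
    by apply: measurable_funM => //; exact: normr_measurable.
  move=> t; rewrite /= in_itv /= -ler_norml normrM normr_id (ger0_norm y0) => ?.
  by rewrite ler_wpM2r.
- move=> t; rewrite /= in_itv /= -ler_norml => ty.
  by rewrite -[leLHS]real_normK ?num_real// expr2 ler_wpM2l.
Qed.

Lemma moment1_nd : {homo moment1 : x y / x <= y}.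
Proof.
move=> x y xy; case: (leP 0 x) => x0.
  rewrite -subr_ge0 -moment1_shell ?x0//; exact: Rintegral_ge0.
rewrite {1}/moment1 set_itv_ge ?Rintegral_set0 ?moment1_ge0//.
by rewrite bnd_simp -ltNge; lra.
Qed.

End Truncations.

(** * Regular variation through ratios *)

Section RegularVariation.
Context {R : realType}.
Implicit Types (t y l rho : R) (f r : R -> R).

Lemma cvg_scale (T : topologicalType) (f : R -> T) (F : set_system T) t :
  0 < t -> f y @[y --> +oo] --> F -> f (t * y) @[y --> +oo] --> F.
Proof. by move=> t0 fl; apply: cvg_comp fl; apply: gt0_cvgMry => //; exact: cvg_id. Qed.

Lemma near_scale (P : set R) t : 0 < t ->
  (\forall y \near +oo, P y) -> \forall y \near +oo, P (t * y).
Proof.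
move=> t0 nP; have : t * y @[y --> +oo] --> +oo.
  by apply: gt0_cvgMry => //; exact: cvg_id.
exact.
Qed.

Lemma near_gt0 : \forall y \near (pinfty_nbhs R), 0 < y.
Proof. exact: nbhs_pinfty_gt. Qed.

(** Since [(t y) `^ rho / y `^ rho = t `^ rho], dividing out the slowly varying
    factor leaves the index in the ratios [r (t y) / r y]; the converse below
    recovers that factor as [r y / y `^ rho]. *)
Lemma regularly_varying_ratio rho r : regularly_varying rho r ->
  (\forall y \near +oo, 0 < r y) /\
  forall t, 0 < t -> r (t * y) / r y @[y --> +oo] --> t `^ rho.
Proof.
move=> [a [a0 _ rpos [l [lsv rE]]]].
have nra : \forall y \near +oo, a < y by apply: nbhs_pinfty_gt; exact: num_real.
split=> [|t t0]; first by apply: filterS nra => y; exact: rpos.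
rewrite -[t `^ rho]mulr1; have /near_eq_cvg : {near +oo,
    (fun y => t `^ rho * (l (t * y) / l y)) =1 (fun y => r (t * y) / r y)}.
  near=> y; have ay : a < y by near: y; exact: nra.
  have aty : a < t * y by near: y; exact: near_scale nra.
  have y0 := le_lt_trans a0 ay.
  have yr0 := powR_gt0 rho y0.
  have ly0 : 0 < l y by have := rpos y ay; rewrite rE// pmulr_rgt0.
  by rewrite !rE// powRM ?ltW//; field; rewrite !gt_eqF.
by move=> h; apply: cvg_trans; first exact: h; apply: cvgM; [exact: cvg_cst|exact: lsv].
Unshelve. all: by end_near. Qed.

Lemma ratio_regularly_varying rho r :
  (forall a : R, 0 < a -> measurable_fun `]a, +oo[ r) ->
  (\forall y \near +oo, 0 < r y) ->
  (forall t, 0 < t -> r (t * y) / r y @[y --> +oo] --> t `^ rho) ->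
  regularly_varying rho r.
Proof.
move=> mr rpos rratio.
have [M [Mreal HM]] := rpos.
exists (Num.max M 1); split.
- by rewrite le_max ler01 orbT.
- by apply: mr; rewrite lt_max ltr01 orbT.
- by move=> y; rewrite gt_max => /andP[My _]; exact: HM.
- exists (fun y => r y / y `^ rho); split=> [t t0|y]; last first.
    rewrite gt_max => /andP[_ y1]; rewrite mulrC divfK// gt_eqF// powR_gt0//.
    exact: lt_trans y1.
  rewrite -[1](@mulfV _ (t `^ rho)) ?gt_eqF ?powR_gt0//.
  have /near_eq_cvg h : {near +oo, (fun y => (r (t * y) / r y) / t `^ rho) =1
     (fun y => (r (t * y) / (t * y) `^ rho) / (r y / y `^ rho))}.
    near=> y; have y0 : 0 < y by near: y; exact: near_gt0.
    have ry0 : 0 < r y by near: y; exact: rpos.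
    have tr0 := powR_gt0 rho t0; have yr0 := powR_gt0 rho y0.
    by rewrite powRM ?ltW//; field; rewrite !gt_eqF.
  by apply: cvg_trans; first exact: h; apply: cvgM; [exact: rratio|exact: cvg_cst].
Unshelve. all: by end_near. Qed.

End RegularVariation.

(** * Rescaled limits of the measure t ^+ 2 dmu *)

Section Asymptotics.
Context {R : realType} (mu : probability (measurableTypeR R) R).
Implicit Types (a b c t x y e : R) (h H : R -> R).
Local Notation U := (moment2 mu).
Local Notation V := (moment1 mu).
Local Notation T := (tail mu).
Context (Upos : \forall y \near +oo, 0 < U y)
  (Uratio : forall t, 0 < t -> U (t * y) / U y @[y --> +oo] --> t).

Lemma moment2_ratio_ge0 t : 0 <= t -> U (t * y) / U y @[y --> +oo] --> t.
Proof.
rewrite le_eqVlt => /predU1P[<-|/Uratio//].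
under eq_fun do rewrite mul0r moment2_0 mul0r.
exact: cvg_cst.
Qed.

Lemma moment2_ratioB a b e : 0 <= a -> 0 <= b -> 0 < e ->
  \forall y \near +oo, `|(U (b * y) - U (a * y)) / U y - (b - a)| <= e.
Proof.
move=> a0 b0 e0.
have /cvgrPdist_le/(_ e e0) : (U (b * y) / U y - U (a * y) / U y) @[y --> +oo] --> b - a.
  by apply: cvgB; exact: moment2_ratio_ge0.
by apply: filterS => y; rewrite distrC mulrBl.
Qed.

Definition nonincreasing_from a h := forall x y, a <= x <= y -> h y <= h x.

(** [H] is a primitive of the decreasing function [h], in the form that
    Riemann sums compare with. *)
Definition primitive_on a H h :=
  forall x y, a <= x <= y -> h y * (y - x) <= H y - H x <= h x * (y - x).

(** Both [weighted_shell] over [U y] and [H b - H a] lie between [h b] and [h a]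
    times, respectively, an increment tending to [b - a] and [b - a] itself. *)
Lemma weighted_shell_step h H A a b e :
  measurable_fun setT h -> nonincreasing_from A h ->
  primitive_on A H h -> 0 <= A -> A <= a <= b -> 0 < e ->
  \forall y \near +oo,
    `|weighted_shell mu h a b y / U y - (H b - H a)| <= (h a - h b) * (b - a) + e.
Proof.
move=> mh hni prim A0 /andP[Aa ab] e0.
have a0 := le_trans A0 Aa; have b0 := le_trans a0 ab.
pose M := `|h a| + `|h b| + 1.
have M0 : 0 < M by rewrite ltr_wpDl// addr_ge0.
have eM : 0 < e / M by rewrite divr_gt0.
near=> y.
have y0 : 0 < y by near: y; exact: near_gt0.
have Uy : 0 < U y by near: y; exact: Upos.
have hd : `|(U (b * y) - U (a * y)) / U y - (b - a)| <= e / M.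
  by near: y; exact: moment2_ratioB.
have hab s : a <= s <= b -> h b <= h s <= h a.
  move=> /andP[as_ sb]; have As := le_trans Aa as_.
  by rewrite !hni ?Aa ?As.
have a0b : 0 <= a <= b by rewrite a0.
have /andP[lo hi] := weighted_shell_bounds mu a0b y0 mh hab.
have /andP[Hlo Hhi] : h b * (b - a) <= H b - H a <= h a * (b - a).
  by apply: prim; rewrite Aa.
move: hd; set d := (_ / U y) => hd; set w := (_ / U y).
have {}lo : h b * d <= w by rewrite /d /w mulrA ler_pM2r ?invr_gt0.
have {}hi : w <= h a * d by rewrite /d /w mulrA ler_pM2r ?invr_gt0.
have dM c : `|c| <= M -> `|c * (d - (b - a))| <= e.
  move=> cM; rewrite normrM; apply: le_trans (_ : M * (e / M) <= e).
    by rewrite ler_pM.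
  by rewrite mulrC divfK// gt_eqF.
have ha : `|h a * (d - (b - a))| <= e.
  by apply: dM; rewrite /M; have := normr_ge0 (h b); lra.
have hb : `|h b * (d - (b - a))| <= e.
  by apply: dM; rewrite /M; have := normr_ge0 (h a); lra.
move: ha hb; rewrite !ler_norml => /andP[ha1 ha2] /andP[hb1 hb2].
apply/andP; split; lra.
Unshelve. all: by end_near. Qed.

(** Summing the one-cell errors over a grid of mesh [d], the jumps of [h]
    telescope. *)
Lemma weighted_shell_grid h H A d k e :
  measurable_fun setT h -> nonincreasing_from A h ->
  primitive_on A H h -> 0 <= A -> 0 <= d -> 0 < e ->
  \forall y \near +oo,
    `|weighted_shell mu h A (A + k%:R * d) y / U y - (H (A + k%:R * d) - H A)|
      <= (h A - h (A + k%:R * d)) * d + e.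
Proof.
move=> mh hni prim A0 d0; elim: k e => [|k IHk] e e0.
  have := weighted_shell_step mh hni prim A0 (_ : A <= A <= A) e0.
  rewrite lexx => /(_ isT); apply: filterS => y.
  by rewrite mul0r addr0 !subrr mulr0 mul0r.
have e2 : 0 < e / 2 by rewrite divr_gt0.
have Ak : A <= A + k%:R * d by rewrite lerDl mulr_ge0.
have kS : A + k.+1%:R * d = A + k%:R * d + d by rewrite -natr1; ring.
have AkS : A <= A + k%:R * d <= A + k.+1%:R * d by rewrite Ak kS lerDl.
near=> y.
have y0 : 0 < y by near: y; exact: near_gt0.
have h1 : `|weighted_shell mu h A (A + k%:R * d) y / U y - (H (A + k%:R * d) - H A)|
      <= (h A - h (A + k%:R * d)) * d + e / 2 by near: y; exact: IHk.
have h2 : `|weighted_shell mu h (A + k%:R * d) (A + k.+1%:R * d) y / U y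
       - (H (A + k.+1%:R * d) - H (A + k%:R * d))|
      <= (h (A + k%:R * d) - h (A + k.+1%:R * d)) * (A + k.+1%:R * d - (A + k%:R * d)) + e / 2.
  by near: y; apply: weighted_shell_step prim _ _ _.
move: h2; rewrite [A + k.+1%:R * d - _](_ : _ = d); last by rewrite kS; ring.
move=> h2; rewrite (weighted_shell_cat mu AkS y0 mh); last first.
  by move=> s /andP[As sk]; rewrite !hni ?lexx ?As.
rewrite mulrDl; move: h1 h2; rewrite !ler_norml => /andP[h11 h12] /andP[h21 h22].
by apply/andP; split; lra.
Unshelve. all: by end_near. Qed.

(** The telescoped error [(h a - h b) * d] vanishes with the mesh [d]. *)
Lemma weighted_shell_cvg h H a b :
  measurable_fun setT h -> nonincreasing_from a h ->
  primitive_on a H h -> 0 <= a <= b ->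
  weighted_shell mu h a b y / U y @[y --> +oo] --> H b - H a.
Proof.
move=> mh hni prim /andP[a0 ab]; apply/cvgrPdist_le => e e0.
have hab0 : 0 <= h a - h b by rewrite subr_ge0 hni// lexx.
have ba0 : 0 <= b - a by rewrite subr_ge0.
pose m := (Num.truncn ((h a - h b) * (b - a) / (e / 2))).+1.
have m0 : 0 < m%:R :> R by rewrite ltr0n.
have mE : (h a - h b) * ((b - a) / m%:R) <= e / 2.
  rewrite mulrA ler_pdivrMr// [leRHS]mulrC -ler_pdivrMr ?divr_gt0//.
  exact/ltW/truncnS_gt.
have d0 : 0 <= (b - a) / m%:R by rewrite divr_ge0// ltW.
have e2 : 0 < e / 2 by rewrite divr_gt0.
have := weighted_shell_grid m mh hni prim a0 d0 e2.
rewrite (_ : a + m%:R * ((b - a) / m%:R) = b); last by field; rewrite gt_eqF.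
apply: filterS => y; rewrite distrC => /le_trans; apply; lra.
Qed.

Lemma tail_ni x y : x <= y -> T y <= T x.
Proof. by move=> xy; rewrite -subr_ge0 -tail_shell// Rintegral_ge0. Qed.

Lemma tail_cvg0 : T y @[y --> +oo] --> 0.
Proof.
pose F n := outside (n%:R : R).
have F0 : \bigcap_n F n = set0.
  apply/seteqP; split => // t /(_ (Num.truncn `|t|).+1 I).
  by rewrite /F /outside /= ltNge ltW// truncnS_gt.
have := @nonincreasing_cvg_mu _ _ _ mu F.
rewrite F0 measure0 => Fc; have {Fc} : mu (F n) @[n --> \oo] --> 0%E.
  apply: Fc => //.
  - by rewrite (le_lt_trans (probability_le1 _ _)) ?ltry//; exact: measurable_outside.
  - by move=> n; exact: measurable_outside.
  - move=> m n mn; rewrite /F /outside; apply/subsetPset => t /=.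
    by apply: le_lt_trans; rewrite ler_nat.
move/fine_cvgP => [_ /cvgrPdist_le cF].
apply/cvgrPdist_le => e e0; have [N _ /(_ N (leqnn N))] := cF e e0.
rewrite !sub0r !normrN /= => TN.
near=> y; rewrite sub0r normrN ger0_norm ?tail_ge0//.
apply: le_trans (tail_ni _) (le_trans (ler_norm _) TN).
by near: y; apply: nbhs_pinfty_ge; exact: num_real.
Unshelve. all: by end_near. Qed.

(** Eventually [U (2 x) <= 3 U x]. So the mass between [x] and [2 x] is at most
    [2 U x / x ^+ 2], and [U x / x ^+ 2] is multiplied by at most [3 / 4] at each
    doubling: the masses of the dyadic shells are dominated by a geometric series
    of sum [8 U x / x ^+ 2]. *)
Lemma tail_bound : \forall x \near +oo, T x <= 8 * U x / x ^+ 2.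
Proof.
have U2 : \forall x \near +oo, U (2 * x) <= 3 * U x.
  near=> x.
  have Ux : 0 < U x by near: x; exact: Upos.
  rewrite -ler_pdivrMr//; apply: ltW; near: x.
  apply: (cvgr_lt 2); last by rewrite ltr_nat.
  exact: Uratio.
have [M M0 HM] : exists2 M, 0 < M & forall x, M < x -> U (2 * x) <= 3 * U x.
  have [M [_ HM]] := U2; exists (Num.max M 1).
    by rewrite lt_max ltr01 orbT.
  by move=> x; rewrite gt_max => /andP[Mx _]; exact: HM.
have iter n x : M < x -> T x <= 8 * U x / x ^+ 2 + T (2 ^+ n * x).
  elim: n x => [|n IHn] x Mx.
    rewrite expr0 mul1r lerDr divr_ge0 ?sqr_ge0// mulr_ge0//; exact: moment2_ge0.
  have x0 := lt_trans M0 Mx.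
  have M2x : M < 2 * x by lra.
  have xx : 0 < x <= 2 * x by lra.
  have := tail_shell_le mu xx; have := IHn _ M2x; have := HM _ Mx.
  rewrite mulrA -exprSr.
  (* [8] solves [c = 2 + c * 3 / 4], which closes the induction. *)
  have -> : 8 * U (2 * x) / (2 * x) ^+ 2 = 2 * U (2 * x) / x ^+ 2.
    by field; rewrite gt_eqF.
  have := moment2_ge0 mu x; have : 0 < (x ^+ 2)^-1 by rewrite invr_gt0 exprn_gt0.
  set i := (x ^+ 2)^-1; set u := U x; set v := U (2 * x) => i0 u0 vu h1 h2.
  have : (3 * u - v) * i >= 0 by rewrite mulr_ge0 ?subr_ge0// ltW.
  have := mulr_ge0 u0 (ltW i0); lra.
near=> x; apply/ler_addgt0Pr => e e0.
have Mx : M < x by near: x; apply: nbhs_pinfty_gt; exact: num_real.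
have x0 := lt_trans M0 Mx.
have [K [_ TK]] : \forall y \near +oo, T y <= e.
  by apply: (cvgr_le 0) => //; exact: tail_cvg0.
pose n := (Num.truncn (K / x)).+1.
apply: le_trans (iter n _ Mx) _; rewrite lerD2l; apply: TK.
rewrite -ltr_pdivrMr//; apply: lt_trans (truncnS_gt _) _.
by rewrite -natrX ltr_nat ltn_expl.
Unshelve. all: by end_near. Qed.

Definition weighted_outside h a y :=
  \int[mu]_(t in outside (a * y)) (h (`|t| / y) * t ^+ 2).

Lemma weight_outside_bounded h a y t : 0 < y ->
  (forall s, a <= s -> 0 <= h s /\ h s * s ^+ 2 <= 1) -> a * y < `|t| ->
  0 <= h (`|t| / y) * t ^+ 2 <= y ^+ 2.
Proof.
move=> y0 hle; rewrite -ltr_pdivlMr// => /ltW/hle [h0 h1].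
rewrite mulr_ge0 ?sqr_ge0//= -[leRHS]mul1r.
have -> : h (`|t| / y) * t ^+ 2 = h (`|t| / y) * (`|t| / y) ^+ 2 * y ^+ 2.
  rewrite expr_div_n real_normK ?num_real// -mulrA divfK//.
  by rewrite gt_eqF// exprn_gt0.
by rewrite ler_wpM2r ?sqr_ge0.
Qed.

Lemma weighted_outside_bounds h a y : 0 < y -> measurable_fun setT h ->
  (forall s, a <= s -> 0 <= h s /\ h s * s ^+ 2 <= 1) ->
  0 <= weighted_outside h a y <= T (a * y) * y ^+ 2.
Proof.
move=> y0 mh hle; apply/andP; split.
  by apply: Rintegral_ge0 => t /(weight_outside_bounded y0 hle)/andP[].
have mo := measurable_outside (a * y).
rewrite -tailE -RintegralZr//; last first.
  by apply: (integrable_bounded mu (M := 1)) => // t _; rewrite normr1.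
apply: le_Rintegral => //.
- apply: (integrable_bounded mu (M := y ^+ 2)) => //; first exact: measurable_weight.
  move=> t /(weight_outside_bounded y0 hle)/andP[h0 h1].
  by rewrite ger0_norm.
- apply: (integrable_bounded mu (M := y ^+ 2)) => // t _.
  by rewrite mul1r ger0_norm ?sqr_ge0.
- by move=> t /(weight_outside_bounded y0 hle)/andP[h0 h1]; rewrite mul1r.
Qed.

(** Cut at [B y]. The shell part converges by [weighted_shell_cvg]. Beyond [B y]
    the weight [h (|t| / y) t ^+ 2] is at most [y ^+ 2], so that part is at most
    [y ^+ 2 * T (B y)], and [tail_bound] makes its ratio to [U y] at most
    [16 / B], uniformly in large [y]. *)
Lemma weighted_outside_cvg h H a l :
  measurable_fun setT h -> nonincreasing_from a h -> primitive_on a H h ->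
  (forall s, a <= s -> 0 <= h s /\ h s * s ^+ 2 <= 1) -> 0 <= a ->
  H s @[s --> +oo] --> l ->
  weighted_outside h a y / U y @[y --> +oo] --> l - H a.
Proof.
move=> mh hni prim hle a0 Hl; apply/cvgrPdist_le => e e0.
have e4 : 0 < e / 4 by rewrite divr_gt0.
have [B [B0 aB HB B16]] : exists B, [/\ 0 < B, a <= B, `|l - H B| <= e / 4
    & 16 / B <= e / 4].
  have : \forall B \near +oo, [/\ 0 < B, a <= B, `|l - H B| <= e / 4
    & 16 / B <= e / 4].
    near=> B; have B0 : 0 < B by near: B; exact: near_gt0.
    split => //.
    - by near: B; move/cvgrPdist_le : Hl; exact.
    - rewrite ler_pdivrMr// [leRHS]mulrC -ler_pdivrMr //.
  by case/pinfty_ex_gt0 => B _; exists B.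
near=> y.
have y0 : 0 < y by near: y; exact: near_gt0.
have Uy : 0 < U y by near: y; exact: Upos.
have hs : `|H B - H a - weighted_shell mu h a B y / U y| <= e / 4.
  near: y; have aaB : 0 <= a <= B by rewrite a0.
  by have /cvgrPdist_le/(_ _ e4) := weighted_shell_cvg mh hni prim aaB.
have tB : T (B * y) <= 8 * U (B * y) / (B * y) ^+ 2.
  by near: y; exact: (@near_scale _ [set x | T x <= 8 * U x / x ^+ 2]) tail_bound.
have UB : U (B * y) / U y <= 2 * B.
  near: y; apply: (cvgr_le B); first exact: Uratio.
  by rewrite ltr_pMl// ltr1n.
have hleB s : B <= s -> 0 <= h s /\ h s * s ^+ 2 <= 1.
  by move=> Bs; apply: hle; exact: le_trans Bs.
have -> : weighted_outside h a y = weighted_shell mu h a B y + weighted_outside h B y.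
  apply: (@Rintegral_outside_shell _ _ _ _ _ (y ^+ 2)).
  - by rewrite ler_pM2r.
  - exact: measurable_weight.
  - move=> t /(weight_outside_bounded y0 hle)/andP[h0 h1].
    by rewrite ger0_norm.
have /andP[wo_ge0 wo_le] := weighted_outside_bounds y0 mh hleB.
have {}wo_le : weighted_outside h B y / U y <= e / 4.
  apply: le_trans B16; rewrite ler_pdivrMr//; apply: le_trans wo_le _.
  apply: le_trans (_ : 8 * U (B * y) / (B * y) ^+ 2 * y ^+ 2 <= _).
    by rewrite ler_wpM2r ?sqr_ge0.
  have -> : 8 * U (B * y) / (B * y) ^+ 2 * y ^+ 2 = 8 * U (B * y) / B ^+ 2.
    by field; rewrite !gt_eqF.
  rewrite ler_pdivrMr ?exprn_gt0//.
  have -> : 16 / B * U y * B ^+ 2 = 8 * (2 * B * U y) by field; rewrite gt_eqF.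
  by rewrite ler_wpM2l// -ler_pdivrMr.
have {}wo_ge0 : 0 <= weighted_outside h B y / U y by rewrite divr_ge0// ltW.
rewrite mulrDl; move: HB hs; rewrite !ler_norml => /andP[? ?] /andP[? ?].
by apply/andP; split; lra.
Unshelve. all: by end_near. Qed.

End Asymptotics.

(** * Tail, Poisson average and first moment *)

Section Consequences.
Context {R : realType} (mu : probability (measurableTypeR R) R).
Implicit Types (a b c t x y e : R).
Local Notation U := (moment2 mu).
Local Notation V := (moment1 mu).
Local Notation T := (tail mu).
Context (Upos : \forall y \near +oo, 0 < U y)
  (Uratio : forall t, 0 < t -> U (t * y) / U y @[y --> +oo] --> t).

Lemma inv_cvg0 : (s^-1) @[s --> +oo] --> (0 : R).
Proof.
apply/cvgrPdist_le => e e0; near=> s.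
have s0 : 0 < s by near: s; exact: near_gt0.
rewrite sub0r normrN ger0_norm ?invr_ge0 ?(ltW s0)//.
rewrite -[s^-1]div1r ler_pdivrMr// mulrC -ler_pdivrMr//.
Unshelve. all: by end_near. Qed.

(** The weight [s ^- 2] on [s > 1] turns [t ^+ 2] into the constant [y ^+ 2], and
    its integral is [1]. *)
Lemma tail_equiv : T y * y ^+ 2 / U y @[y --> +oo] --> (1 : R).
Proof.
pose h s : R := (s ^+ 2)^-1; pose H s : R := - s^-1.
have mh : measurable_fun setT h.
  apply: measurable_funV_ge0; last exact: exprn_measurable.
  by move=> t; exact: sqr_ge0.
have hni : nonincreasing_from 1 h.
  move=> x y /andP[x1 xy]; rewrite /h lef_pV2 ?posrE ?exprn_gt0//; try lra.
  by rewrite lerXn2r// nnegrE; lra.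
have prim : primitive_on 1 H h.
  move=> x y /andP[x1 xy]; have x0 : 0 < x by lra.
  have y0 : 0 < y by lra.
  have -> : H y - H x = (y - x) / (x * y) by rewrite /H; field; rewrite !gt_eqF.
  have xy0 : 0 < x * y by rewrite mulr_gt0.
  rewrite /h ![_^-1 * _]mulrC !ler_wpM2l ?subr_ge0// !lef_pV2 ?posrE ?exprn_gt0//.
    by rewrite expr2 ler_wpM2l// ltW.
  by rewrite expr2 ler_wpM2r// ltW.
have hle s : 1 <= s -> 0 <= h s /\ h s * s ^+ 2 <= 1.
  move=> s1; rewrite /h invr_ge0 sqr_ge0 mulVf// gt_eqF// exprn_gt0//; lra.
have Hl : H s @[s --> +oo] --> (0 : R).
  by rewrite -oppr0; apply: cvgN; exact: inv_cvg0.
have := weighted_outside_cvg Upos Uratio mh hni prim hle ler01 Hl.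
rewrite /H invr1 sub0r opprK; apply: cvg_trans; apply: near_eq_cvg.
near=> y; have y0 : 0 < y by near: y; exact: near_gt0.
congr (_ / _); rewrite /weighted_outside mul1r -tailE -RintegralZr//; last 2 first.
- exact: measurable_outside.
- apply: (integrable_bounded mu (M := 1)) => //; first exact: measurable_outside.
  by move=> t _; rewrite normr1.
apply: eq_Rintegral => t; rewrite inE /outside /= => yt.
have t0 : t ^+ 2 != 0 by rewrite sqrf_eq0 -normr_gt0; exact: lt_trans yt.
rewrite /h expr_div_n real_normK ?num_real//; field.
by rewrite gt_eqF//=; move: t0; rewrite sqrf_eq0.
Unshelve. all: by end_near. Qed.

(** Up to the factor [y^-1], the imaginary part of [G_mu (i y) - 1 / (i y)]: one
    minus the Poisson integral of [mu] at height [y], normalized to be [1] for the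
    point mass at [0]. *)
Definition poisson_moment y := \int[mu]_t (t ^+ 2 / (t ^+ 2 + y ^+ 2)).

Lemma atan_primitive : primitive_on 0 (@atan R) (fun s => (1 + s ^+ 2)^-1).
Proof.
move=> x y /andP[x0 xy].
have [c /andP[/= xc cy] ->] : exists2 c, c \in `[x, y]%R &
    atan y - atan x = (1 + c ^+ 2)^-1 * (y - x).
  apply: MVT_segment => //.
  by apply: continuous_subspaceT => z; exact: continuous_atan.
have pos z : 0 < 1 + z ^+ 2 :> R by rewrite ltr_pwDl// sqr_ge0.
have le z w : 0 <= z <= w -> (1 + w ^+ 2)^-1 <= (1 + z ^+ 2)^-1 :> R.
  move=> /andP[z0 zw]; rewrite lef_pV2 ?posrE// lerD2l lerXn2r// nnegrE//.
  exact: le_trans zw.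
rewrite !bnd_simp in xc cy.
by apply/andP; split; apply: ler_wpM2r; rewrite ?subr_ge0//; apply: le;
  rewrite ?x0 ?xc ?cy ?(le_trans x0 xc).
Qed.

(** The weight is [1 / (1 + s ^+ 2)] on [s > 0], of integral [pi / 2]. *)
Lemma poisson_moment_equiv :
  poisson_moment y * y ^+ 2 / U y @[y --> +oo] --> (pi / 2 : R).
Proof.
pose h s : R := (1 + s ^+ 2)^-1.
have pos z : 0 < 1 + z ^+ 2 :> R by rewrite ltr_pwDl// sqr_ge0.
have mh : measurable_fun setT h.
  apply: measurable_funV_ge0; last by apply: measurable_funD => //; exact: exprn_measurable.
  by move=> t; exact/ltW.
have hni : nonincreasing_from 0 h.
  move=> x y /andP[x0 xy]; rewrite /h lef_pV2 ?posrE// lerD2l.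
  by rewrite lerXn2r// nnegrE; lra.
have hle s : 0 <= s -> 0 <= h s /\ h s * s ^+ 2 <= 1.
  move=> s0; rewrite /h invr_ge0 ltW//; split => //.
  by rewrite mulrC ler_pdivrMr// mul1r lerDr.
have := weighted_outside_cvg Upos Uratio mh hni atan_primitive hle (lexx 0) (@cvgy_atan R).
rewrite atan0 subr0; apply: cvg_trans; apply: near_eq_cvg.
near=> y; have y0 : 0 < y by near: y; exact: near_gt0.
have y20 : 0 < y ^+ 2 by rewrite exprn_gt0.
congr (_ / _); rewrite /poisson_moment -RintegralZr//; last first.
  apply: (integrable_bounded mu (M := 1)) => //.
    apply: measurable_funM; first exact: exprn_measurable.
    apply: measurable_funV_ge0; first by move=> t; rewrite addr_ge0// sqr_ge0.
    by apply: measurable_funD => //; exact: exprn_measurable.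
  move=> t _; rewrite ger0_norm ?divr_ge0 ?addr_ge0 ?sqr_ge0//.
  by rewrite ler_pdivrMr ?ltr_wpDl ?sqr_ge0// mul1r lerDl sqr_ge0.
rewrite /weighted_outside Rintegral_mkcond mul0r.
apply: eq_Rintegral => t _; rewrite patchE; case: ifPn => [_|].
  rewrite /h expr_div_n real_normK ?num_real//; field.
  by rewrite !gt_eqF// ltr_wpDl// sqr_ge0.
rewrite notin_setE /outside /= normr_gt0 => /negP; rewrite negbK => /eqP ->.
by rewrite expr0n/= !mul0r.
Unshelve. all: by end_near. Qed.

(** The shell from [y / 2] to [y] adds at least [(U y - U (y / 2)) / y], about
    [U y / (2 y)], to [V (y / 2)], while [U (y / 2) / (y / 2)] is about [U y / y].
    So the constant [c] can be raised by anything below [1 / 2]. *)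
Lemma moment1_dominates_step c : 1 <= c ->
  (\forall y \near +oo, c * U y <= V y * y) ->
  \forall y \near +oo, (c + 1 / 4) * U y <= V y * y.
Proof.
move=> c1 Pc; have c0 : 0 < 2 * c - 1 by lra.
(* The loss allowed on [U (y / 2) / U y -> 1 / 2] so that exactly [1 / 4] of the
   gain [1 / 2] survives. *)
pose d := 1 / 2 - 1 / 4 / (2 * c - 1).
have hd : \forall y \near +oo, d <= U (2^-1 * y) / U y.
  apply: (cvgr_ge 2^-1); first by apply: Uratio; rewrite invr_gt0.
  have : 0 < 1 / 4 / (2 * c - 1) by rewrite divr_gt0// divr_gt0.
  by rewrite /d; lra.
have half0 : 0 < 2^-1 :> R by rewrite invr_gt0.
near=> y; have y0 : 0 < y by near: y; exact: near_gt0.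
have Uy : 0 < U y by near: y; exact: Upos.
have Ph : c * U (2^-1 * y) <= V (2^-1 * y) * (2^-1 * y).
  by near: y; exact: (@near_scale _ [set x | c * U x <= V x * x]) Pc.
have dy : d * U y <= U (2^-1 * y) by rewrite -ler_pdivlMr//; near: y; exact: hd.
have hy : 0 < 2^-1 * y <= y by lra.
have /andP[] := moment1_shell_bounds mu hy; rewrite ler_pdivrMr// => h1 _.
have : (2 * c - 1) * (d * U y) <= (2 * c - 1) * U (2^-1 * y) by rewrite ler_pM2l.
have -> : (2 * c - 1) * (d * U y) = (c - 1 / 2 - 1 / 4) * U y.
  by rewrite /d; field; rewrite gt_eqF.
lra.
Unshelve. all: by end_near. Qed.

Lemma moment1_dominates c : \forall y \near +oo, c * U y <= V y * y.
Proof.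
have Pn n : \forall y \near +oo, (1 + n%:R / 4) * U y <= V y * y.
  elim: n => [|n IHn].
    near=> y; have y0 : 0 < y by near: y; exact: near_gt0.
    by rewrite mul0r addr0 mul1r moment2_le_moment1// ltW.
  rewrite (_ : 1 + _ = 1 + n%:R / 4 + 1 / 4); last by rewrite -natr1; lra.
  by apply: moment1_dominates_step => //; rewrite lerDl divr_ge0.
have [n cn] : exists n, c <= 1 + n%:R / 4.
  exists (Num.truncn (c * 4)).+1; have := truncnS_gt (c * 4); lra.
apply: filterS (Pn n) => y; apply: le_trans.
by rewrite ler_wpM2r// moment2_ge0.
Unshelve. all: by end_near. Qed.

Lemma moment1_gt0 : \forall y \near +oo, 0 < V y.
Proof.
near=> y; have y0 : 0 < y by near: y; exact: near_gt0.
have Uy : 0 < U y by near: y; exact: Upos.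
have : 1 * U y <= V y * y by near: y; exact: moment1_dominates.
by rewrite mul1r => /(lt_le_trans Uy); rewrite pmulr_lgt0.
Unshelve. all: by end_near. Qed.

Lemma moment2_littleo : U y / (y * V y) @[y --> +oo] --> (0 : R).
Proof.
apply/cvgrPdist_le => e e0; near=> y.
have y0 : 0 < y by near: y; exact: near_gt0.
have Vy : 0 < V y by near: y; exact: moment1_gt0.
have : e^-1 * U y <= V y * y by near: y; exact: moment1_dominates.
rewrite sub0r normrN ger0_norm; last first.
  by rewrite divr_ge0 ?moment2_ge0// mulr_ge0// ltW.
rewrite ler_pdivrMr ?mulr_gt0// [e^-1 * _]mulrC ler_pdivrMr//; lra.
Unshelve. all: by end_near. Qed.

(** [V (t y) / V y - 1] is at most [(U (t y) / U y - 1) * (U y / (y V y))], where the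
    first factor tends to [t - 1] and the second one to [0]. *)
Lemma moment1_slow_gt1 t : 1 < t -> V (t * y) / V y @[y --> +oo] --> (1 : R).
Proof.
move=> t1; have t0 : 0 < t by lra.
have bd : (U (t * y) / U y - 1) * (U y / (y * V y)) @[y --> +oo] --> (0 : R).
  rewrite -(mulr0 (t - 1)); apply: cvgM; last exact: moment2_littleo.
  by apply: cvgB; [exact: Uratio|exact: cvg_cst].
rewrite -[1 in X in _ --> X]add0r.
have sub0 : V (t * y) / V y - 1 @[y --> +oo] --> (0 : R).
  apply: squeeze_cvgr bd; last exact: (cvg_cst 0).
  near=> y; have y0 : 0 < y by near: y; exact: near_gt0.
  have Uy : 0 < U y by near: y; exact: Upos.
  have Vy : 0 < V y by near: y; exact: moment1_gt0.
  have yty : 0 < y <= t * y by rewrite y0 ler_pMl// ltW.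
  apply/andP; split; first by rewrite subr_ge0 ler_pdivlMr// mul1r moment1_nd//; lra.
  have /andP[_ h] := moment1_shell_bounds mu yty.
  rewrite -(ler_pM2r Vy); apply: le_trans (_ : V (t * y) - V y <= _).
    by rewrite mulrBl divfK ?mul1r// gt_eqF.
  apply: le_trans h _; rewrite le_eqVlt; apply/orP; left; apply/eqP.
  by field; rewrite !gt_eqF.
have : V (t * y) / V y - 1 + 1 @[y --> +oo] --> (0 + 1 : R).
  by apply: cvgD => //; exact: cvg_cst.
by under eq_fun do rewrite subrK.
Unshelve. all: by end_near. Qed.

(** For [t < 1] the ratio is the inverse of the one for [t^-1], read at [t y]. *)
Lemma moment1_slow t : 0 < t -> V (t * y) / V y @[y --> +oo] --> (1 : R).
Proof.
move=> t0; have [t1|t1|->] := ltgtP t 1.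
- have ti : 1 < t^-1 by rewrite invf_gt1.
  have := cvg_scale t0 (moment1_slow_gt1 ti).
  under eq_fun do rewrite mulrA mulVf ?gt_eqF// mul1r.
  move/(cvgV (oner_neq0 _)); rewrite invr1; apply: cvg_trans.
  by apply: near_eq_cvg; near=> y; rewrite /= invf_div.
- exact: moment1_slow_gt1.
- apply/cvgrPdist_le => e e0; near=> y.
  have Vy : 0 < V y by near: y; exact: moment1_gt0.
  by rewrite mul1r divff ?gt_eqF// subrr normr0 ltW.
Unshelve. all: by end_near. Qed.

End Consequences.

(** * Real and imaginary parts of the Cauchy transform *)

Section CauchyTransform.
Context {R : realType} (mu : probability (measurableTypeR R) R).
Implicit Types (a b c t x y e : R).
Local Notation U := (moment2 mu).
Local Notation T := (tail mu).
Local Notation J := (poisson_moment mu).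

Definition cauchy_re y := \int[mu]_t (- (t / (t ^+ 2 + y ^+ 2))).

Lemma inv_iyBt y t : ('i%C * y%:C - t%:C)^-1 =
  (- (t / (t ^+ 2 + y ^+ 2))) +i* (- (y / (t ^+ 2 + y ^+ 2))).
Proof.
have -> : 'i%C * y%:C - t%:C = (- t) +i* y by simpc.
by rewrite /GRing.inv /= sqrrN mulNr.
Qed.

Lemma measurable_sum_sqrV y : measurable_fun setT (fun t => (t ^+ 2 + y ^+ 2)^-1).
Proof.
apply: measurable_funV_ge0; first by move=> t; rewrite addr_ge0// sqr_ge0.
by apply: measurable_funD => //; exact: exprn_measurable.
Qed.

Lemma sum_sqr_gt0 t y : 0 < y -> 0 < t ^+ 2 + y ^+ 2.
Proof. by move=> y0; rewrite ltr_wpDl ?sqr_ge0// exprn_gt0. Qed.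

Lemma integrable_poisson y D : 0 < y -> measurable D ->
  mu.-integrable D (EFin \o (fun t => t ^+ 2 / (t ^+ 2 + y ^+ 2))).
Proof.
move=> y0 mD; apply: (integrable_bounded mu (M := 1)) => //.
  by apply: measurable_funM; [exact: exprn_measurable|exact: measurable_sum_sqrV].
move=> t _; rewrite ger0_norm ?divr_ge0 ?addr_ge0 ?sqr_ge0//.
by rewrite ler_pdivrMr ?sum_sqr_gt0// mul1r lerDl sqr_ge0.
Qed.

(** [t ^+ 2 / (y (t ^+ 2 + y ^+ 2)) = y^-1 - y / (t ^+ 2 + y ^+ 2)], and [mu] has
    total mass [1]. *)
Lemma poisson_momentE y : 0 < y ->
  y^-1 * J y = y^-1 + \int[mu]_t (- (y / (t ^+ 2 + y ^+ 2))).
Proof.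
move=> y0; have mT := @measurableT _ (measurableTypeR R).
have y2 : 0 < y ^+ 2 by rewrite exprn_gt0.
rewrite /poisson_moment -RintegralZl//; last exact: integrable_poisson.
have cE : \int[mu]_(t in setT) y^-1 = y^-1.
  rewrite Rintegral_cst// (_ : fine _ = 1) ?mulr1//.
  exact: (congr1 fine (probability_setT mu)).
rewrite -[X in _ = X + _]cE -RintegralD//.
- apply: eq_Rintegral => t _. field.
  by rewrite !gt_eqF// sum_sqr_gt0.
- by apply: (integrable_bounded mu (M := `|y^-1|)).
- apply: (integrable_bounded mu (M := y^-1)) => //.
    apply: measurableT_comp => //; apply: measurable_funM => //.
    exact: measurable_sum_sqrV.
  move=> t _; rewrite normrN ger0_norm ?divr_ge0 ?addr_ge0 ?sqr_ge0 ?(ltW y0)//.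
  rewrite ler_pdivrMr ?sum_sqr_gt0// mulrC ler_pdivlMr//.
  by rewrite -expr2 lerDr sqr_ge0.
Qed.

Lemma cauchy_transform_iy y : 0 < y ->
  cauchy_transform mu ('i%C * y%:C) - ('i%C * y%:C)^-1 =
  cauchy_re y +i* (y^-1 * J y).
Proof.
move=> y0; have yN0 : y != 0 by rewrite gt_eqF.
rewrite poisson_momentE// /cauchy_transform /complex_integral.
have -> : ('i%C * y%:C)^-1 = 0 +i* (- y^-1).
  have := inv_iyBt y 0; rewrite subr0 => ->.
  by rewrite mul0r oppr0 expr0n add0r expr2 invfM mulrA divff// mul1r.
rewrite (@eq_Rintegral _ _ _ mu _ (fun t => - (t / (t ^+ 2 + y ^+ 2)))); last first.
  by move=> t _; rewrite inv_iyBt.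
rewrite [X in _ +i* X - _](@eq_Rintegral _ _ _ mu _ (fun t => - (y / (t ^+ 2 + y ^+ 2)))); last first.
  by move=> t _; rewrite inv_iyBt.
by apply/eqP; rewrite eq_complex /= oppr0 addr0 opprK addrC !eqxx.
Qed.

(** Inside [-y, y] the kernels [t / y ^+ 2] and [t / (t ^+ 2 + y ^+ 2)] differ by
    at most [t ^+ 2 / y ^+ 3]; outside, the second one is at most [y^-1]. *)
Lemma cauchy_re_bound y : 0 < y ->
  `|cauchy_re y + y ^- 2 * \int[mu]_(t in `[- y, y]) t| <= U y / y ^+ 3 + T y / y.
Proof.
move=> y0; have y2 : 0 < y ^+ 2 by rewrite exprn_gt0.
have mI := measurable_itv `[- y, y].
have mO := measurable_outside y.
pose k t : R := - (t / (t ^+ 2 + y ^+ 2)).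
have mk : measurable_fun setT k.
  apply: measurableT_comp => //; apply: measurable_funM => //.
  exact: measurable_sum_sqrV.
have kle t : `|k t| <= y^-1.
  rewrite /k normrN normrM [X in _ * X]ger0_norm ?invr_ge0 ?addr_ge0 ?sqr_ge0//.
  rewrite ler_pdivrMr ?sum_sqr_gt0// mulrC ler_pdivlMr//.
  rewrite -(real_normK (num_real t)); have := sqr_ge0 (`|t| - y).
  by have := normr_ge0 t; nra.
have ik D : measurable D -> mu.-integrable D (EFin \o k).
  by move=> mD; apply: (integrable_bounded mu (M := y^-1)).
have it : mu.-integrable `[- y, y] (EFin \o (fun t => y ^- 2 * t)).
  apply: (integrable_bounded mu (M := `|y ^- 2| * y)) => //.
    exact: measurable_funM.
  by move=> t; rewrite /= in_itv /= -ler_norml normrM => ty; rewrite ler_wpM2l.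
have it0 : mu.-integrable `[- y, y] (EFin \o (fun t : R => t)).
  apply: (integrable_bounded mu (M := y)) => //.
  by move=> t; rewrite /= in_itv /= -ler_norml.
have -> : cauchy_re y =
    \int[mu]_(t in `[- y, y]) k t + \int[mu]_(t in outside y) k t.
  rewrite -Rintegral_setU//.
  - congr Rintegral; apply/seteqP; split => // t _ /=.
    by rewrite in_itv /= -ler_norml /outside /=; apply/orP; rewrite leNgt orNb.
  - by apply: ik; exact: measurableU.
  - apply/disj_setPS => t []; rewrite /outside /= in_itv /= -ler_norml leNgt.
    by move/negP.
rewrite addrAC -RintegralZl// -RintegralD//; last exact: ik.
apply: le_trans (ler_normD _ _) _; apply: lerD.
  have mkd : measurable_fun setT (fun t => k t + y ^- 2 * t).
    by apply: measurable_funD => //; exact: measurable_funM.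
  have kdle t : `|t| <= y -> `|k t + y ^- 2 * t| <= y^-1 + `|y ^- 2| * y.
    move=> ty; apply: le_trans (ler_normD _ _) _.
    by rewrite lerD// normrM ler_wpM2l.
  apply: le_trans (le_normr_Rintegral _ _) _ => //.
    apply: (integrable_bounded mu (M := y^-1 + `|y ^- 2| * y)) => // t.
    by rewrite /= in_itv /= -ler_norml; exact: kdle.
  have isq : mu.-integrable `[- y, y] (EFin \o (fun t : R => t ^+ 2)).
    apply: (integrable_bounded mu (M := y ^+ 2)) => //.
    by move=> t; rewrite /= in_itv /= -ler_norml; exact: sqr_le_norm.
  rewrite -RintegralZr//; apply: le_Rintegral => //.
  - apply: (integrable_bounded mu (M := y^-1 + `|y ^- 2| * y)) => //.
      exact: measurableT_comp.
    by move=> t; rewrite /= in_itv /= -ler_norml normr_id; exact: kdle.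
  - apply: (integrable_bounded mu (M := y ^+ 2 * `|y ^- 3|)) => //.
      by apply: measurable_funM => //; exact: exprn_measurable.
    move=> t; rewrite /= in_itv /= -ler_norml normrM => ty.
    by rewrite ler_wpM2r//; exact: sqr_le_norm.
  - move=> t _; have p := sum_sqr_gt0 t y0.
    have -> : k t + y ^- 2 * t = t ^+ 2 * (t / (y ^+ 2 * (t ^+ 2 + y ^+ 2))).
      by rewrite /k; field; rewrite !gt_eqF.
    rewrite normrM (ger0_norm (sqr_ge0 t)) ler_wpM2l ?sqr_ge0//.
    have := kle t; rewrite /k normrN => kt.
    have -> : t / (y ^+ 2 * (t ^+ 2 + y ^+ 2)) = t / (t ^+ 2 + y ^+ 2) * y ^- 2.
      by field; rewrite !gt_eqF.
    rewrite normrM (ger0_norm (_ : 0 <= y ^- 2)) ?invr_ge0 ?sqr_ge0//.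
    have -> : y ^- 3 = y^-1 * y ^- 2 by field; rewrite gt_eqF.
    by rewrite ler_wpM2r// invr_ge0 sqr_ge0.
apply: le_trans (le_normr_Rintegral _ _) _ => //; first exact: ik.
rewrite -tailE -RintegralZr//; last first.
  by apply: (integrable_bounded mu (M := 1)) => // t _; rewrite normr1.
apply: le_Rintegral => //.
- apply: (integrable_bounded mu (M := y^-1)) => //; first exact: measurableT_comp.
  by move=> t _; rewrite normr_id.
- apply: (integrable_bounded mu (M := `|y^-1|)) => //.
  by move=> t _; rewrite mul1r.
- by move=> t _; rewrite mul1r.
Qed.

Lemma poisson_moment_ni x y : 0 <= x <= y -> J y <= J x.
Proof.
move=> /andP[x0 xy].
have [->|xN0] := eqVneq x y; first exact: lexx.
have y0 : 0 < y by rewrite (le_lt_trans x0)// lt_neqAle xN0.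
apply: le_Rintegral => //; first exact: integrable_poisson.
  apply: (integrable_bounded mu (M := 1)) => //.
    by apply: measurable_funM; [exact: exprn_measurable|exact: measurable_sum_sqrV].
  move=> t _; rewrite ger0_norm ?divr_ge0 ?addr_ge0 ?sqr_ge0//.
  have [->|t0] := eqVneq t 0; first by rewrite expr0n mul0r.
  have t2 : 0 < t ^+ 2 by rewrite lt_neqAle eq_sym sqrf_eq0 t0 sqr_ge0.
  by rewrite ler_pdivrMr ?ltr_pwDl ?sqr_ge0// mul1r lerDl sqr_ge0.
move=> t _; have [->|t0] := eqVneq t 0; first by rewrite expr0n !mul0r.
have t2 : 0 < t ^+ 2 by rewrite lt_neqAle eq_sym sqrf_eq0 t0 sqr_ge0.
rewrite ler_wpM2l ?(ltW t2)// lef_pV2 ?posrE ?ltr_pwDl ?sqr_ge0//.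
by rewrite lerD2l lerXn2r// nnegrE// ltW.
Qed.

(** [J] is monotone on nonnegative reals only, being even; composing it with
    [max y 0] gives a monotone function on the whole line. *)
Lemma measurable_imag_part a : 0 < a ->
  measurable_fun `]a, +oo[ (fun y => y^-1 * J y).
Proof.
move=> a0; apply: (@eq_measurable_fun _ _ _ _ _ (fun y => y `^ (-1) * J (Num.max y 0))).
  move=> y; rewrite inE /= in_itv /= andbT => ay.
  have y0 := lt_trans a0 ay.
  by rewrite powR_inv1 ?(ltW y0)// max_l// ltW.
apply: measurable_funS (measurableT) (subsetT _) _ .
apply: measurable_funM; first exact: measurable_powR.
apply: nonincreasing_measurable => // x y xy; apply: poisson_moment_ni.
by rewrite le_max lexx orbT/= ge_max !le_max xy lexx orbT.
Qed.

End CauchyTransform.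

(** * The terms of the expansion *)

Section ExpansionTerms.
Context {R : realType} (mu : probability (measurableTypeR R) R).
Implicit Types (t x y e : R).
Local Notation U := (moment2 mu).
Local Notation V := (moment1 mu).
Local Notation T := (tail mu).
Local Notation J := (poisson_moment mu).
Context (Upos : \forall y \near +oo, 0 < U y)
  (Uratio : forall t, 0 < t -> U (t * y) / U y @[y --> +oo] --> t).

Lemma pi_half_gt0 : 0 < pi / 2 :> R.
Proof. by rewrite divr_gt0// pi_gt0. Qed.

Lemma poisson_moment_gt0 : \forall y \near +oo, 0 < J y.
Proof.
near=> y; have y0 : 0 < y by near: y; exact: near_gt0.
have Uy : 0 < U y by near: y; exact: Upos.
have : 0 < J y * y ^+ 2 / U y.
  near: y; apply: (cvgr_gt (pi / 2)); last exact: pi_half_gt0.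
  exact: poisson_moment_equiv.
by rewrite pmulr_lgt0 ?invr_gt0// pmulr_lgt0// exprn_gt0.
Unshelve. all: by end_near. Qed.

Lemma tail_gt0 : \forall y \near +oo, 0 < T y.
Proof.
near=> y; have y0 : 0 < y by near: y; exact: near_gt0.
have Uy : 0 < U y by near: y; exact: Upos.
have : 0 < T y * y ^+ 2 / U y.
  by near: y; apply: (cvgr_gt 1) => //; exact: tail_equiv.
by rewrite pmulr_lgt0 ?invr_gt0// pmulr_lgt0// exprn_gt0.
Unshelve. all: by end_near. Qed.

(** [f y] is asymptotic to a constant times [U y / y ^+ 3], so its ratios tend to
    [t / t ^+ 3]. *)
Lemma regularly_varying_imag_part : regularly_varying (- 2) (fun y => y^-1 * J y).
Proof.
apply: ratio_regularly_varying => [a|| t t0].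
- exact: measurable_imag_part.
- near=> y; have y0 : 0 < y by near: y; exact: near_gt0.
  by rewrite mulr_gt0 ?invr_gt0//; near: y; exact: poisson_moment_gt0.
have pN0 : pi / 2 != 0 :> R by rewrite gt_eqF// pi_half_gt0.
have := poisson_moment_equiv Upos Uratio; move: (pi / 2) pN0 => p pN0 JU.
have -> : t `^ (- 2) = t ^- 3 * (p / p * t).
  by rewrite powR_invn ?(ltW t0)//; field; rewrite pN0 gt_eqF.
have : t ^- 3 * ((J (t * y) * (t * y) ^+ 2 / U (t * y)) / (J y * y ^+ 2 / U y)
    * (U (t * y) / U y)) @[y --> +oo] --> t ^- 3 * (p / p * t).
  apply: cvgM; first exact: cvg_cst.
  apply: cvgM; last exact: Uratio.
  apply: cvgM; last exact: cvgV.
  exact: (cvg_scale (f := fun y => J y * y ^+ 2 / U y)).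
apply: cvg_trans; apply: near_eq_cvg; near=> y.
have y0 : 0 < y by near: y; exact: near_gt0.
have Uy : 0 < U y by near: y; exact: Upos.
have Jy : 0 < J y by near: y; exact: poisson_moment_gt0.
have Uty : 0 < U (t * y) by near: y; exact: (@near_scale _ [set x | 0 < U x]) Upos.
by field; rewrite !gt_eqF.
Unshelve. all: by end_near. Qed.

Lemma regularly_varying_moment1_scaled : regularly_varying (- 2) (fun y => y ^- 2 * V y).
Proof.
apply: ratio_regularly_varying => [a a0|| t t0].
- apply: measurable_funS (measurableT) (subsetT _) _.
  apply: measurable_funM; last first.
    by apply: nondecreasing_measurable => //; exact: moment1_nd.
  apply: measurable_funV_ge0.
    by move=> y; exact: sqr_ge0.
  exact: exprn_measurable.
- near=> y; have y0 : 0 < y by near: y; exact: near_gt0.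
  by rewrite mulr_gt0 ?invr_gt0 ?exprn_gt0//; near: y; exact: moment1_gt0.
rewrite powR_invn ?(ltW t0)// -[t ^- 2]mulr1.
have : t ^- 2 * (V (t * y) / V y) @[y --> +oo] --> t ^- 2 * 1.
  by apply: cvgM; [exact: cvg_cst|exact: moment1_slow].
apply: cvg_trans; apply: near_eq_cvg; near=> y.
have y0 : 0 < y by near: y; exact: near_gt0.
have Vy : 0 < V y by near: y; exact: moment1_gt0.
by field; rewrite !gt_eqF.
Unshelve. all: by end_near. Qed.

Lemma imag_part_equiv :
  asymp_equiv (fun y => y^-1 * J y) (fun y => pi / 2 * y^-1 * T y).
Proof.
have pN0 : pi / 2 != 0 :> R by rewrite gt_eqF// pi_half_gt0.
rewrite /asymp_equiv; have := poisson_moment_equiv Upos Uratio.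
move: (pi / 2) pN0 => p pN0 JU.
have -> : 1 = p^-1 * (p / 1) by rewrite divr1 mulVf.
have : p^-1 * ((J y * y ^+ 2 / U y) / (T y * y ^+ 2 / U y)) @[y --> +oo] -->
    p^-1 * (p / 1).
  apply: cvgM; first exact: cvg_cst.
  apply: cvgM; first exact: JU.
  by apply: cvgV => //; exact: tail_equiv.
apply: cvg_trans; apply: near_eq_cvg; near=> y.
have y0 : 0 < y by near: y; exact: near_gt0.
have Uy : 0 < U y by near: y; exact: Upos.
have Ty : 0 < T y by near: y; exact: tail_gt0.
by field; rewrite pN0 !gt_eqF.
Unshelve. all: by end_near. Qed.

Lemma tail_littleo : T y * y / V y @[y --> +oo] --> (0 : R).
Proof.
rewrite -(mulr0 1).
have : (T y * y ^+ 2 / U y) * (U y / (y * V y)) @[y --> +oo] --> (1 * 0 : R).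
  by apply: cvgM; [exact: tail_equiv|exact: moment2_littleo].
apply: cvg_trans; apply: near_eq_cvg; near=> y.
have y0 : 0 < y by near: y; exact: near_gt0.
have Uy : 0 < U y by near: y; exact: Upos.
have Vy : 0 < V y by near: y; exact: moment1_gt0.
by field; rewrite !gt_eqF.
Unshelve. all: by end_near. Qed.

Lemma cauchy_re_littleo :
  (cauchy_re mu y + y ^- 2 * \int[mu]_(t in `[- y, y]) t) / (y ^- 2 * V y)
    @[y --> +oo] --> (0 : R).
Proof.
have bd : U y / (y * V y) + T y * y / V y @[y --> +oo] --> (0 : R).
  by rewrite -(addr0 0); apply: cvgD; [exact: moment2_littleo|exact: tail_littleo].
apply/norm_cvg0P; apply: squeeze_cvgr bd; last exact: (cvg_cst 0).
near=> y; have y0 : 0 < y by near: y; exact: near_gt0.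
have Vy : 0 < V y by near: y; exact: moment1_gt0.
have g0 : 0 < y ^- 2 * V y by rewrite mulr_gt0 ?invr_gt0 ?exprn_gt0.
rewrite normr_ge0 normrM [X in _ * X]ger0_norm ?invr_ge0 ?(ltW g0)//.
rewrite ler_pdivrMr//; apply: le_trans (cauchy_re_bound mu y0) _.
rewrite le_eqVlt; apply/orP; left; apply/eqP.
by field; rewrite !gt_eqF.
Unshelve. all: by end_near. Qed.

End ExpansionTerms.

(** * The expansion *)

Theorem proposition5p11 (R : realType) (theta : R)
    (mu : probability (measurableTypeR R) R) :
  -1 <= theta <= 1 ->
  stable_class1 theta mu ->
  exists f g : R -> R,
    [/\ regularly_varying (- 2) f,
        regularly_varying (- 2) g,
        exists eps : R -> R,
          eps y @[y --> +oo] --> (0 : R) /\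
          \forall y \near +oo,
            cauchy_transform mu ('i%C * y%:C) - ('i%C * y%:C)^-1 =
              - (y ^- 2 * \int[mu]_(t in `[- y, y]) t)%:C
              + 'i%C * (f y)%:C + (eps y * g y)%:C,
        asymp_equiv g (fun y => y ^- 2 * \int[mu]_(t in `[- y, y]) `|t|) &
        asymp_equiv f
          (fun y => pi / 2 * y^-1 * fine (mu [set t | y < `|t|])) /\
        (fun y => pi / 2 * y^-1 * fine (mu [set t | y < `|t|]) : R^o)
          =o_ (pinfty_nbhs R) (g : R -> R^o)].
Proof.
move=> _ [/regularly_varying_ratio[Upos Uratio1] _].
have Uratio t : 0 < t -> moment2 mu (t * y) / moment2 mu y @[y --> +oo] --> t.
  by move=> t0; have := Uratio1 t t0; rewrite powRr1// ltW.
exists (fun y => y^-1 * poisson_moment mu y), (fun y => y ^- 2 * moment1 mu y).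
split.
- exact: regularly_varying_imag_part.
- exact: regularly_varying_moment1_scaled.
- exists (fun y => (cauchy_re mu y + y ^- 2 * \int[mu]_(t in `[- y, y]) t) /
    (y ^- 2 * moment1 mu y)); split; first exact: cauchy_re_littleo.
  near=> y; have y0 : 0 < y by near: y; exact: near_gt0.
  have Vy : 0 < moment1 mu y by near: y; exact: moment1_gt0.
  rewrite cauchy_transform_iy// divfK; last first.
    by rewrite gt_eqF// mulr_gt0// invr_gt0 exprn_gt0.
  apply/eqP; rewrite eq_complex /=; apply/andP; split; apply/eqP; ring.
- rewrite /asymp_equiv; apply: cvg_trans (_ : cst 1 @ pinfty_nbhs R --> (1 : R)); last exact: cvg_cst.
  apply: near_eq_cvg; near=> y; have y0 : 0 < y by near: y; exact: near_gt0.
  have Vy : 0 < moment1 mu y by near: y; exact: moment1_gt0.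
  by rewrite -/(moment1 mu y) divff// gt_eqF// mulr_gt0// invr_gt0 exprn_gt0.
- split; first exact: imag_part_equiv.
  have p0 : 0 < pi / 2 :> R by exact: pi_half_gt0.
  apply/eqoP => e e0; near=> y.
  have y0 : 0 < y by near: y; exact: near_gt0.
  have Vy : 0 < moment1 mu y by near: y; exact: moment1_gt0.
  rewrite -/(outside y) -/(tail mu y) !ger0_norm; last 2 first.
  + by rewrite mulr_ge0 ?(ltW Vy)// invr_ge0 sqr_ge0.
  + by rewrite mulr_ge0 ?tail_ge0// mulr_ge0 ?(ltW p0)// invr_ge0 ltW.
  have : tail mu y * y / moment1 mu y <= e / (pi / 2).
    near: y; apply: (cvgr_le 0); first exact: tail_littleo.
    exact: divr_gt0.
  move: (pi / 2) (p0) => p pp0; rewrite ler_pdivrMr// => small.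
  have -> : p * y^-1 * tail mu y = p * y ^- 2 * (tail mu y * y).
    by field; rewrite gt_eqF.
  have -> : e * (y ^- 2 * moment1 mu y) = p * y ^- 2 * (e / p * moment1 mu y).
    by field; rewrite !gt_eqF.
  by rewrite ler_pM2l// mulr_gt0// invr_gt0 exprn_gt0.
Unshelve. all: by end_near. Qed.
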